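(* Let $X\subset I^{\omega_1}$ be a productively Lindelöf Menger space, and let $\mathcal G$ be an Alster covering of $X$ of size $|\mathcal G|=\omega_1$ consisting of Lindelöf $G_\delta$-subsets of $I^{\omega_1}$. Then there exists a countable subfamily $\mathcal G'\in[\mathcal G]^{\omega}$ such that $X\subset\bigcup\mathcal G'$.
   Context: $I=[0,1]$ and $I^{\omega_1}$ carries the product topology; $X$ carries the subspace topology. $[\mathcal G]^\omega$ is the set of countably infinite subsets of $\mathcal G$. A Lindelöf space $X$ is productively Lindelöf if $X\times Y$ is Lindelöf for every Lindelöf space $Y$. A space $X$ is Menger if for every sequence $(\mathcal U_n)_{n\in\omega}$ of open coverings of $X$ there are finite $\mathcal V_n\subset\mathcal U_n$ such that $\bigcup_{n\in\omega}\bigcup\mathcal V_n=X$. A family $\mathcal G$ of $G_\delta$ sets is an Alster covering of $X$ if for every compact $K\subset X$ there is $G\in\mathcal G$ with $K\subset G$. Here the members of $\mathcal G$ are $G_\delta$-subsets of the ambient space $I^{\omega_1}$ (not necessarily contained in $X$), each Lindelöf as a subspace. *)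

(* Defs.v *)
From HB Require Import structures.
From mathcomp Require Import all_boot all_order all_algebra.
From mathcomp Require Import all_classical all_reals all_analysis.
From mathcomp Require Import wochoice borel_hierarchy.

Set Implicit Arguments.
Unset Strict Implicit.
Unset Printing Implicit Defensive.

Import Order.TTheory GRing.Theory Num.Theory.
Import numFieldNormedType.Exports.

Local Open Scope classical_set_scope.
Local Open Scope ring_scope.

(* [omega1 R] says that the (reflexive) well-order [R] has order type omega_1,
   the least uncountable ordinal.  All such well-orders are isomorphic; one
   exists by [omega1_exists] below. *)
Definition omega1 (W : eqType) (R : rel W) : Prop :=
  [/\ well_order R, ~ countable [set: W]
    & forall x : W, countable [set y | R y x]].

Definition unit_interval (R : realType) : topologicalType :=
  set_type ([set` `[0, 1]] : set R).

Definition cube (R : realType) (W : Type) : topologicalType :=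
  prod_topology (fun _ : W => unit_interval R).

Definition open_covering (T : topologicalType) (U : set (set T)) : Prop :=
  (forall A, U A -> open A) /\ \bigcup_(A in U) A = [set: T].

Definition lindelof (T : topologicalType) : Prop :=
  forall U : set (set T), open_covering U ->
    exists V : set (set T),
      [/\ V `<=` U, countable V & \bigcup_(A in V) A = [set: T]].

Definition productively_lindelof (T : topologicalType) : Prop :=
  lindelof T /\
  forall Y : topologicalType, lindelof Y -> lindelof (T * Y)%type.

Definition menger (T : topologicalType) : Prop :=
  forall U : nat -> set (set T), (forall n, open_covering (U n)) ->
    exists V : nat -> set (set T),
      (forall n, V n `<=` U n /\ finite_set (V n)) /\
      \bigcup_n \bigcup_(A in V n) A = [set: T].

(* The members of [G] are G_delta in the ambient space and need not be
   contained in [X]. *)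
Definition alster_covering (T : topologicalType) (X : set T)
    (G : set (set T)) : Prop :=
  (forall A, G A -> Gdelta A) /\
  (forall K : set T, compact K -> K `<=` X -> exists2 A, G A & K `<=` A).

Lemma uncountable_set_nat : ~ countable [set: set nat].
Proof.
rewrite /countable => /pcard_leP[f].
pose D : set nat := [set n | exists2 A : set nat, f A = n & ~ A n].
have nD : ~ D (f D).
  move=> [A fA nA]; apply: (nA); suff -> : A = D by exists A.
  by apply: (@inj _ _ [set: set nat] f) fA; rewrite in_setT.
by apply: (nD); exists D.
Qed.

Lemma omega1_exists : exists (W : eqType) (R : rel W), omega1 R.
Proof.
pose T : eqType := {classic (set nat)}.
have [R Rwo] := well_ordering_principle T.
have [Rc|] := pselect (forall x : T, countable [set y | R y x]).
  by exists T, R; split=> //; exact: uncountable_set_nat.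
move=> /existsNP[x0 ucx0].
pose B : pred T := fun x => `[< ~ countable [set y | R y x] >].
have [|x [[/asboolP Bx xmin] _]] := Rwo B; first by exists x0; exact/asboolP.
have Ranti : antisymmetric R.
  by move=> a b; exact: (@wo_chain_antisymmetric T R predT (withinW Rwo)).
pose P : pred T := fun y => R y x && (y != x).
pose W : eqType := {y : T | P y}.
pose S : rel W := fun a b => R (val a) (val b).
have Pc y : P y -> countable [set z | R z y].
  move=> /andP[yx nyx]; apply: contrapT => /asboolP By.
  by move/negP: nyx; apply; apply/eqP/Ranti; rewrite yx xmin.
exists W, S; split.
- apply: antisymmetric_well_order.
    by move=> a b ab; apply: val_inj; exact: Ranti.
  move=> A [a Aa].
  pose A' : pred T := fun y => `[< exists2 w : W, w \in A & val w = y >].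
  have [|_ [[/asboolP[w Aw <-] wmin] _]] := Rwo A'.
    by exists (val a); apply/asboolP; exists a.
  exists w; split=> // b Ab; apply: wmin; apply/asboolP.
  by exists b.
- move=> cW; apply: Bx.
  pose F (b : bool) : set T := if b then [set val w | w in [set: W]] else [set x].
  apply: (@sub_countable _ _ _ (\bigcup_b F b)).
    apply: subset_card_le => y /= Ryx.
    have [->|nyx] := eqVneq y x; [by exists false|exists true => //].
    have Py : P y by rewrite /P Ryx.
    by exists (exist _ y Py).
  apply: bigcup_countable => [|[] _]; first exact: countableP.
    exact: sub_countable (card_image_le _ _) cW.
  exact: countable1.
- move=> w; apply: (@sub_countable _ _ _ [set z | R z (val w)]).
    by apply: (@card_ge_preimage _ _ [set z | R z (val w)] val) => a b _ _; exact: val_inj.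
  exact: Pc (valP w).
Qed.

(* Main.v *)
Require Import Defs.
From HB Require Import structures.
From mathcomp Require Import all_boot all_order all_algebra.
From mathcomp Require Import all_classical all_reals all_analysis.
From mathcomp Require Import wochoice.

(** The theorem is a diagonal argument.  Index the family by the well-order,
    [range g = G], and let [T d] be the union of the [g b] with [b] below [d].
    If no countable subfamily covers [X], choose [a d] in [X] outside [T d] for
    every [d].  The contradiction comes from a Lindelof space [Y] whose product
    with [X] is not Lindelof.

    The points of [Y] are the indices, made isolated, and the pairs [(d, z)]
    where [z] lies outside [T d] and no point of [X] agrees with [z] on the
    coordinates below [d].  A neighbourhood of [(d, z)] is given by a basic box
    around [z] that constrains coordinates below [d] only; it contains the
    pairs [(c, y)] with [c >= d] and the indices [b] whose [y], respectively
    [a b], is in the box.  In the product with [X] the points [(a b, b)] form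
    a closed discrete set: a point of [X] and a pair [(d, z)] differ at a
    coordinate below [d] and boxes at that coordinate separate them
    ([michael_product]).

    That [Y] is Lindelof ([michael_lindelof]) is the heart of the matter.
    Given an open cover, let [C d] be what remains of the cube after removing
    the boxes over coordinates below [d] that give, at level [d], a
    neighbourhood inside a member of the cover.  There are only countably many
    such boxes, and as soon as [C d] is contained in [T d] they take care of
    all pairs and all indices from [d] on.  So one needs such a [d].  What is
    known is that every point of [C d] outside [T d] agrees below [d] with a
    point of [X], for otherwise it would give a point of [Y] at level [d].

    Such a [d] exists by [absorbing_index], where the Menger property
    enters.  Suppose that all [C d `\` T d] are nonempty, and call a
    set positive if it meets all of them.  They decrease along an order in
    which countable sets are bounded, so a countable union is positive only if
    one of its members is.  A positive set accumulates positively at a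
    point outside [X]: otherwise its points of positive accumulation form a
    compact subset of [X], which is contained in a member of [G], a
    G-delta set whose complement then fails to be positive ([pos_escape]).
    Hence the first player of the Menger game can play as follows, keeping a
    positive closed set [B]: cover [X] by cylinders that stay away from a point
    outside [X] at which [B] accumulates positively; whatever finitely many
    cylinders are answered, removing them from [B] leaves a positive set,
    and then [B] can be shrunk further to miss a prescribed [g b].
    Taking [d] closed under this strategy, all [g b] with [b] below [d] can be
    treated in the course of one play while only coordinates below [d] are
    used.  The first player has no winning strategy in the game on a
    Menger space ([menger_game]), so some play covers [X].  Compactness gives a
    point of [C d] in all the sets [B] of this play; it is outside [T d], so it
    agrees below [d] with a point of [X], hence lies in one of the cylinders
    that were removed. *)

Set Implicit Arguments.
Unset Strict Implicit.
Unset Printing Implicit Defensive.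

Import Order.TTheory GRing.Theory Num.Theory.
Import numFieldNormedType.Exports.

Local Open Scope classical_set_scope.

(** * Countable sets and filters *)

Lemma countable_setU (T : Type) (A B : set T) :
  countable A -> countable B -> countable (A `|` B).
Proof.
move=> cA cB; have -> : A `|` B = \bigcup_b (if b then A else B).
  apply/seteqP; split=> x; first by move=> [?|?]; [exists true | exists false].
  by move=> [[] _ ?]; [left | right].
apply: bigcup_countable => [|[] _]; first exact: countableP.
  exact: cA.
exact: cB.
Qed.

Lemma countable_enum (T : Type) (A : set T) : countable A -> A !=set0 ->
  exists e : nat -> T, range e = A.
Proof.
move=> /countable_injP[f finj] [a0 Aa0].
have /choice[e he] : forall n, exists a,
    A a /\ forall b, A b -> f b = n -> b = a.
  move=> n; have [[a [Aa fa]]|na] := pselect (exists a, A a /\ f a = n).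
    exists a; split=> // b Ab fb.
    by apply: finj; rewrite ?inE // fb fa.
  by exists a0; split=> // b Ab fb; exfalso; apply: na; exists b.
exists e; apply/seteqP; split=> [_ [n _ <-]|a Aa]; first exact: (he n).1.
by exists (f a) => //; rewrite -((he (f a)).2 a Aa).
Qed.

Lemma filter_bigcap_lt (T : Type) (F : set_system T) (A : nat -> set T) n :
  Filter F -> (forall i, (i < n)%N -> F (A i)) -> F (\bigcap_(i in `I_n) A i).
Proof.
move=> FF; elim: n => [|n IH] FA.
  have -> : `I_0 = set0 by apply/seteqP; split.
  by rewrite bigcap_set0; exact: filterT.
rewrite IIS bigcap_setU bigcap_set1; apply: filterI; last exact: FA.
by apply: IH => i /ltnW; exact: FA.
Qed.

(** * The Menger game *)

Section MengerGame.
Variable T : topologicalType.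

(** Histories are lists with the latest answer first. *)
Fixpoint play (f : nat -> nat) (n : nat) : seq nat :=
  if n is m.+1 then f m :: play f m else [::].

(** [U (k :: s)] is the set won by the [k]-th answer after the history [s]. *)
Variable U : seq nat -> set T.
Hypothesis U_open : forall k s, open (U (k :: s)).
Hypothesis U_mono : forall k m s, (k <= m)%N -> U (k :: s) `<=` U (m :: s).
Hypothesis U_cover : forall s x, exists k, U (k :: s) x.

Fixpoint gained (s : seq nat) : set T :=
  if s is k :: s' then U s `|` gained s' else set0.

(** The points gained when [m] is answered, whatever the [n] answers between
    the history [s] and [m] are. *)
Fixpoint level (n m : nat) (s : seq nat) : set T :=
  if n is n'.+1 then \bigcap_k level n' m (k :: s) else gained (m :: s).

Lemma gained_open s : open (gained s).
Proof. by elim: s => [|k s IH] /=; [exact: open0 | exact: openU]. Qed.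

Lemma gained_sub_level n m s : gained s `<=` level n m s.
Proof.
elim: n m s => [|n IH] m s x sx /=; first by right.
by move=> k _; apply: IH; right.
Qed.

Lemma level_mono n k m s : (k <= m)%N -> level n k s `<=` level n m s.
Proof.
move=> km; elim: n s => [|n IH] s x /=.
  by move=> [/(U_mono km)|]; [left | right].
by move=> h i _; exact/IH/h.
Qed.

Lemma level_sub_play n (f : nat -> nat) m i :
  level n m (play f i) `<=` gained (m :: play f (n + i)).
Proof.
elim: n i => [|n IH] i x //= h.
by move: (h (f i) Logic.I) => /(IH i.+1 x); rewrite addnS.
Qed.

Lemma level_eventually n s x : exists m, level n m s x.
Proof.
elim: n s => [|n IH] s /=.
  by have [k kx] := U_cover s x; exists k; left.
have [j jx] := U_cover s x.
have [m hm] : exists m, forall k, (k < j)%N -> level n m (k :: s) x.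
  elim: j {jx} => [|j [m hm]]; first by exists 0%N.
  have [m' hm'] := IH (j :: s); exists (maxn m m') => k.
  rewrite ltnS leq_eqVlt => /orP[/eqP ->|/hm].
    exact: level_mono (leq_maxr _ _) _ hm'.
  exact: level_mono (leq_maxl _ _) _.
exists m => k _; have [/hm //|jk] := ltnP k j.
by apply: gained_sub_level; left; exact: U_mono jk _ jx.
Qed.

(** Although [level] is defined by an infinite intersection, near a point of
    [U (j :: s)] the terms with [k >= j] are automatic, since they retain what
    the answer [k] has won; only finitely many conditions remain. *)
Lemma level_open n m s : open (level n m s).
Proof.
elim: n s => [|n IH] s /=; first exact: (gained_open (m :: s)).
rewrite openE => x hx; have [j jx] := U_cover s x.
have : nbhs x (U (j :: s) `&` \bigcap_(k in `I_j) level n m (k :: s)).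
  apply: filterI; first exact: open_nbhs_nbhs.
  apply: filter_bigcap_lt => k _; apply: open_nbhs_nbhs.
  by split; [exact: IH | exact: hx].
apply: filterS => y [jy hy] k _; have [/hy //|jk] := ltnP k j.
by apply: gained_sub_level; left; exact: U_mono jk _ jy.
Qed.

Lemma gained_play f n x : gained (play f n) x ->
  exists i, U (f i :: play f i) x.
Proof.
by elim: n => [|n IH] //= [?|/IH //]; exists n.
Qed.

(** Hurewicz's theorem, in the conceptual proof of Szewczak and Tsaban: a
    selection from the open covers formed by the sets [level n m [::]], which
    anticipate all histories of length [n], is a winning sequence of answers. *)
Lemma menger_game : menger T ->
  exists f, forall x, exists n, U (f n :: play f n) x.
Proof.
move=> mT.
have [|V [VU Vcov]] := mT (fun n => range (fun m => level n m [::])).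
  move=> n; split=> [_ [m _ <-]|]; first exact: level_open.
  apply/seteqP; split=> // x _; have [m hm] := level_eventually n [::] x.
  by exists (level n m [::]) => //; exists m.
have /choice[f hf] : forall n, exists m,
    \bigcup_(A in V n) A `<=` level n m [::].
  move=> n; have [sV fV] := VU n.
  have : forall A, exists m, V n A -> A = level n m [::].
    move=> A; have [/sV[m _ <-]|] := pselect (V n A); first by exists m.
    by exists 0%N.
  move=> /choice[g hg].
  have [b hb] : exists b, forall A, V n A -> (g A <= b)%N.
    have /finite_fsetP[s hs] := finite_image g fV.
    exists (\max_(i <- finmap.enum_fset s) i)%N => A VA.
    have : (g @` V n) (g A) by exists A.
    rewrite hs /= => gs; exact: (@leq_bigmax_seq _ _ predT id).
  exists b => x [A VA]; rewrite {1}(hg A VA).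
  by apply: level_mono; exact: hb.
exists f => x; have : [set: T] x by [].
rewrite -Vcov => -[n _ /hf/(@level_sub_play n f (f n) 0)]; rewrite addn0.
exact: (@gained_play f n.+1).
Qed.

End MengerGame.

(** * Countable subsets of the first uncountable well-order *)

Section Omega1.
Variables (W : eqType) (R : rel W).
Hypothesis RW : omega1 R.

Definition below (d : W) : set W := [set b | ~~ R d b].

Let Rtot : total R.
Proof.
by case: RW => wo _ _ x y; exact: (@wo_chainW W R predT (withinW wo)).
Qed.

Let Ranti : antisymmetric R.
Proof.
case: RW => wo _ _ x y.
exact: (@wo_chain_antisymmetric W R predT (withinW wo)).
Qed.

Lemma omega1_neq0 : [set: W] !=set0.
Proof.
apply/set0P/eqP => W0; case: RW => _ + _; apply; rewrite W0.
exact: countable0.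
Qed.

Lemma omega1_refl : reflexive R.
Proof. by move=> x; have := Rtot x x; rewrite orbb. Qed.

Lemma omega1_trans : transitive R.
Proof.
move=> y x z Rxy Ryz; case: RW => wo _ _.
have [|m [[mA lb] _]] := wo [pred w | w \in [:: x; y; z]].
  by exists x; rewrite !inE eqxx.
have mx : R m x by apply: lb; rewrite !inE eqxx.
have my : R m y by apply: lb; rewrite !inE eqxx orbT.
have mz : R m z by apply: lb; rewrite !inE eqxx !orbT.
move: mA; rewrite !inE => /or3P[] /eqP mE; subst m => //.
  by rewrite (@Ranti x y) // Rxy mx.
by rewrite -(@Ranti y z) // Ryz my.
Qed.

Lemma below_le d b : below d b -> R b d.
Proof. by rewrite /below /=; have /orP[->|] := Rtot d b. Qed.

Lemma below_subset c d : R c d -> below c `<=` below d.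
Proof. by move=> Rcd b /=; apply: contra; apply: omega1_trans. Qed.

Lemma le_below b c d : R b c -> below d c -> below d b.
Proof. by move=> Rbc; apply: contra => /omega1_trans; apply. Qed.

Lemma countable_below d : countable (below d).
Proof.
case: RW => _ _ /(_ d); apply: sub_countable; apply: subset_card_le => b.
exact: below_le.
Qed.

Lemma countable_bounded (A : set W) : countable A -> exists d, A `<=` below d.
Proof.
move=> cA; apply: contrapT => nA; case: RW => _ ucW cR; apply: ucW.
apply: (@sub_countable _ _ _ (\bigcup_(a in A) [set y | R y a])); last first.
  by apply: bigcup_countable => // a _; exact: cR.
apply: subset_card_le => d _; apply: contrapT => nd.
by apply: nA; exists d => a Aa; apply/negP => Rda; apply: nd; exists a.
Qed.

Lemma seq_bounded (u : nat -> W) : exists d, forall n, below d (u n).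
Proof.
have [|d hd] := @countable_bounded (range u).
  exact: sub_countable (card_image_le _ _) (countableP _).
by exists d => n; apply: hd; exists n.
Qed.

Lemma omega1_sup (A : set W) : countable A ->
  exists d, A `<=` below d /\ forall b, below d b -> exists2 a, A a & R b a.
Proof.
move=> /countable_bounded[e Ae]; case: RW => wo _ _.
have [|d [[/asboolP Ad dmin] _]] := wo [pred d | `[< A `<=` below d >]].
  by exists e; exact/asboolP.
exists d; split=> // b; apply: contraNP => nb; apply: dmin.
apply/asboolP => a Aa.
by apply/negP => Rba; apply: nb; exists a.
Qed.

Lemma countable_lists (V : countType) d :
  countable [set s : seq (W * V) | forall p, p \in s -> below d p.1].
Proof.
have /countable_injP[f finj] := countable_below d.
have inj : {in [set s : seq (W * V) | forall p, p \in s -> below d p.1] &,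
    injective (map (fun p => (f p.1, p.2)))}.
  move=> s t; rewrite !inE /= => sd td.
  elim: s t sd td => [|[a v] s IH] [|[b w] t] //= sd td [fab -> st].
  congr ((_, _) :: _); last first.
    by apply: IH => // p ps; [apply: sd | apply: td]; rewrite inE ps orbT.
  apply: finj => //; rewrite inE.
    by apply: (sd (a, v)); rewrite mem_head.
  by apply: (td (b, w)); rewrite mem_head.
rewrite -(eq_countable (inj_card_eq inj)); exact: countableP.
Qed.

(** The usual closing-off argument: iterate a bound for [u] on the lists below
    the current index, and take the supremum of the resulting sequence. *)
Lemma closing_off (V : countType) (u : seq (W * V) -> W) (c : W) : exists d,
  below d c /\
  forall s, (forall p, p \in s -> below d p.1) -> R (u s) d.
Proof.
have /choice[F hF] : forall d, exists e, below e d /\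
    forall s : seq (W * V), (forall p, p \in s -> below d p.1) -> below e (u s).
  move=> d.
  pose lists := [set s : seq (W * V) | forall p, p \in s -> below d p.1].
  have [|e he] := @countable_bounded ([set d] `|` u @` lists).
    apply: countable_setU; first exact: countable1.
    exact: sub_countable (card_image_le _ _) (countable_lists _ _).
  exists e; split; first by apply: he; left.
  by move=> s sd; apply: he; right; exists s.
pose v n := iter n F c.
have v_mono m n : (m <= n)%N -> R (v m) (v n).
  elim: n => [|n IH]; first by rewrite leqn0 => /eqP ->; exact: omega1_refl.
  rewrite leq_eqVlt => /orP[/eqP ->|]; first exact: omega1_refl.
  rewrite ltnS => /IH h; apply: omega1_trans h _.
  by apply: below_le; exact: (hF _).1.
have [|d [vd dsup]] := @omega1_sup (range v).
  exact: sub_countable (card_image_le _ _) (countableP _).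
exists d; split; first by apply: vd; exists 0%N.
move=> s sd; have [n hn] : exists n, forall p, p \in s -> below (v n) p.1.
  elim: s sd => [|p s IH] sd; first by exists 0%N.
  have [|n hn] := IH; first by move=> q qs; apply: sd; rewrite inE qs orbT.
  have [|_ [m _ <-] hm] := dsup p.1; first by apply: sd; rewrite mem_head.
  exists (maxn m.+1 n) => q; rewrite inE => /orP[/eqP ->|/hn].
    apply: below_subset (v_mono _ _ (leq_maxl _ _)) _ _.
    exact: le_below hm (hF _).1.
  exact: below_subset (v_mono _ _ (leq_maxr _ _)) _.
apply: omega1_trans (below_le (vd (v n.+1) _)); last by exists n.+1.
by apply: below_le; exact: (hF (v n)).2.
Qed.

End Omega1.

(** * Powers of a compact second countable space *)

Lemma lindelof_subsequence (T : topologicalType) (X : set T) (I : Type)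
    (P : I -> Prop) (C : I -> set T) : lindelof (set_type X) -> X !=set0 ->
  (forall i, open (C i)) -> (forall x, X x -> exists2 i, P i & C i x) ->
  exists e : nat -> I, (forall n, P (e n)) /\
    forall x, X x -> exists n, C (e n) x.
Proof.
move=> lX [x0 Xx0] oC cov.
pose pre i : set (set_type X) := set_val @^-1` C i.
have [|V [VU cV covV]] := lX [set A | exists2 i, P i & A = pre i].
  split=> [_ [i _ ->]|]; first by exists (C i).
  apply/seteqP; split=> // x _; have [i Pi Cx] := cov (set_val x) (set_valP x).
  by exists (pre i) => //; exists i.
have [|v vV] := countable_enum cV.
  have : [set: set_type X] (exist _ x0 (mem_set Xx0)) by [].
  by rewrite -covV => -[A VA _]; exists A.
have /choice[e he] : forall n, exists i, P i /\ v n = pre i.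
  move=> n; have [|i Pi ->] := VU (v n); first by rewrite -vV; exists n.
  by exists i.
exists e; split=> [n|x Xx]; first exact: (he n).1.
have : [set: set_type X] (exist _ x (mem_set Xx)) by [].
rewrite -covV -vV => -[_ [n _ <-]]; rewrite (he n).2 => h.
by exists n.
Qed.

Section Products.
Variables (W : eqType) (K : topologicalType) (J : nat -> set K).
Hypothesis K_compact : compact [set: K].
Hypothesis K_hausdorff : hausdorff_space K.
Hypothesis J_open : forall n, open (J n).
Hypothesis J_base : forall (U : set K) x, open U -> U x ->
  exists2 n, J n x & J n `<=` U.

Local Notation E := (prod_topology (fun _ : W => K)).

Definition cyl (p : W * nat) : set E := [set z | J p.2 (z p.1)].

Lemma coord_open (i : W) (U : set K) : open U -> open [set z : E | U (z i)].
Proof.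
move=> oU; apply: (@open_comp _ _ (fun z : E => z i)) oU => z _.
exact: (@proj_continuous W (fun=> K) i).
Qed.

Lemma cyl_open p : open (cyl p).
Proof. exact: coord_open (J_open p.2). Qed.

Lemma product_compact : compact [set: E].
Proof.
have := @tychonoff W (fun=> K) (fun=> setT) (fun=> K_compact).
by congr (compact _); apply/seteqP; split.
Qed.

Lemma coord_separation (x y : E) i : x i <> y i ->
  exists n, J n (x i) /\
    exists2 U : set K, open U & U (y i) /\ J n `&` U = set0.
Proof.
move=> xy; move: (K_hausdorff); rewrite open_hausdorff => /(_ (x i) (y i)).
case; first exact/eqP.
move=> [A B] /= [/set_mem xA /set_mem yB] [oA oB /eqP AB].
have [n Jx JA] := J_base oA xA.
exists n; split=> //; exists B => //; split=> //.
by apply/seteqP; split=> // z [/JA Az Bz]; rewrite -AB.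
Qed.

Lemma cyl_separation (x y : E) : x <> y ->
  exists2 p, cyl p x & nbhs y (~` cyl p).
Proof.
move=> xy; have [i xyi] : exists i, x i <> y i.
  apply: contrapT => /forallNP h; apply: xy; apply/funext => i.
  by apply: contrapT; exact: h.
have [n [Jx [U oU [Uy JU]]]] := coord_separation xyi.
exists (i, n) => //.
have : nbhs y [set z : E | U (z i)].
  by apply: open_nbhs_nbhs; split=> //; exact: coord_open.
apply: filterS => z Uz Jz; have : (J n `&` U) (z i) by [].
by rewrite JU.
Qed.

(** Only finite intersections of cylinders are recorded, so a countable set of
    coordinates supports countably many boxes. *)
Definition box (s : seq (W * nat)) : set E :=
  [set z | forall p, p \in s -> cyl p z].

Lemma open_box s : open (box s).
Proof.
elim: s => [|p s IH].
  have -> : box [::] = setT by apply/seteqP; split.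
  exact: openT.
rewrite (_ : box (p :: s) = cyl p `&` box s).
  by apply: openI => //; exact: cyl_open.
apply/seteqP; split=> [z h|z [pz sz] q].
  by split=> [|q qs]; apply: h; [exact: mem_head | rewrite inE qs orbT].
by rewrite inE => /orP[/eqP -> //|/sz].
Qed.

End Products.

(** * Positive sets *)

Section Grill.
Variables (T : topologicalType) (X : set T) (G : set (set T)).
Variable pos : set T -> Prop.
Hypothesis T_compact : compact [set: T].
Hypothesis X_alster : alster_covering X G.
(** The sets that are not positive form a sigma-ideal that, by [pos_diff],
    contains all members of [G]. *)
Hypothesis pos0 : ~ pos set0.
Hypothesis pos_sub : forall A B, A `<=` B -> pos A -> pos B.
Hypothesis pos_bigcup : forall A : nat -> set T,
  pos (\bigcup_n A n) -> exists n, pos (A n).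
Hypothesis pos_diff : forall A B, G A -> pos B -> pos (B `\` A).

Let pos_setU A B : pos (A `|` B) -> pos A \/ pos B.
Proof.
move=> pAB; have [|[|n]] := @pos_bigcup (fun n => if n is 0%N then A else B).
- by apply: pos_sub pAB => x [?|?]; [exists 0%N | exists 1%N].
- by left.
- by right.
Qed.

(** The sets that contain [A `&` B] up to a set that is not positive form a
    proper filter; a cluster point of it is a point of positive
    accumulation. *)
Lemma pos_cluster A B : closed A -> pos (A `&` B) ->
  exists2 z, A z & forall U, nbhs z U -> pos (U `&` B).
Proof.
move=> cA pAB.
pose F : set_system T := [set S | ~ pos (A `&` B `&` ~` S)].
have FF : ProperFilter F.
  apply: Build_ProperFilter_ex => [S FS|].
    apply: contrapT => /forallNP nS; apply: FS.
    by apply: pos_sub pAB => x ABx; split=> //; exact: nS.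
  split=> [|S1 S2 F1 F2|S1 S2 S12 F1].
  - by rewrite /F /= setCT setI0.
  - rewrite /F /= setCI setIUr => /pos_setU[]; [exact: F1 | exact: F2].
  - move=> p2; apply: F1; apply: pos_sub p2 => x [ABx nS2]; split=> //.
    by move=> /S12.
have FA : F A by rewrite /F /= setIAC setICr set0I.
have cptA : compact A by apply: (subclosed_compact cA T_compact).
have [z [Az zF]] := cptA F FF FA.
exists z => // U zU; apply: contrapT => nUB.
have FU : F (~` U).
  by rewrite /F /= setCK => p; apply: nUB; apply: pos_sub p => x [[_ ?] ?].
by have [x []] := zF _ _ FU zU.
Qed.

(** The complement of a G-delta set is a countable union of closed sets, one of
    which keeps a positive part of [B]. *)
Lemma pos_diff_closed A B : G A -> closed B -> pos B ->
  exists B', [/\ closed B', pos B' & B' `<=` B `\` A].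
Proof.
move=> GA cB pB; have [V oV AV] := X_alster.1 A GA.
have [|n pn] := @pos_bigcup (fun n => B `\` V n).
  apply: pos_sub (pos_diff GA pB) => x [Bx]; rewrite AV => nA.
  apply: contrapT => nx; apply: nA => n _; apply: contrapT => nVx.
  by apply: nx; exists n.
exists (B `\` V n); split=> //; last first.
  by rewrite AV => x [Bx nV]; split=> // /(_ n Logic.I).
by apply: closedI => //; apply: open_closedC.
Qed.

(** If all points of positive accumulation of [B] were in [X], they would form a
    compact set [L], contained in some [A] in [G].  As [B `\` A] is positive, so
    is the part of [B] outside one of the open sets whose intersection is [A];
    that part accumulates positively outside this open set, hence outside
    [L]. *)
Lemma pos_escape B : pos B ->
  exists2 z, ~ X z & forall U, nbhs z U -> pos (U `&` B).
Proof.
move=> pB; pose L : set T := [set z | forall U, nbhs z U -> pos (U `&` B)].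
have cL : closed L.
  move=> z clz U; rewrite nbhsE => -[V [oV Vz] VU].
  have [y [Ly Vy]] := clz V (open_nbhs_nbhs (conj oV Vz)).
  have := Ly V (open_nbhs_nbhs (conj oV Vy)).
  by apply: pos_sub => x [/VU].
apply: contrapT => nz.
have LX : L `<=` X by move=> z Lz; apply: contrapT => nXz; apply: nz; exists z.
have cptL : compact L by apply: (subclosed_compact cL T_compact).
have [A GA LA] := X_alster.2 L cptL LX.
have [V oV AV] := X_alster.1 A GA.
have [|n pn] := @pos_bigcup (fun n => ~` V n `&` B).
  apply: pos_sub (pos_diff GA pB) => x [Bx]; rewrite AV => nA.
  apply: contrapT => nx; apply: nA => n _; apply: contrapT => nVx.
  by apply: nx; exists n.
have [z nVz zL] := pos_cluster (open_closedC (oV n)) pn.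
have : A z by apply: LA.
by rewrite AV => /(_ n Logic.I).
Qed.

End Grill.

(** * Absorption of decreasing closed sets *)

Section Absorption.
Variables (W : eqType) (R : rel W) (K : topologicalType) (J : nat -> set K).
Hypothesis RW : omega1 R.
Hypothesis K_compact : compact [set: K].
Hypothesis K_hausdorff : hausdorff_space K.
Hypothesis J_open : forall n, open (J n).
Hypothesis J_base : forall (U : set K) x, open U -> U x ->
  exists2 n, J n x & J n `<=` U.

Local Notation E := (prod_topology (fun _ : W => K)).

Variables (X : set E) (G : set (set E)) (g : W -> set E) (C : W -> set E).
Hypothesis X_neq0 : X !=set0.
Hypothesis X_lindelof : lindelof (set_type X).
Hypothesis X_menger : menger (set_type X).
Hypothesis G_alster : alster_covering X G.
Hypothesis G_range : range g = G.
Hypothesis C_closed : forall d, closed (C d).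
Hypothesis C_anti : forall c d, R c d -> C d `<=` C c.

Let T d := \bigcup_(b in below R d) g b.

Hypothesis C_sat : forall d z, C d z -> ~ T d z ->
  exists2 x, X x & forall i, below R d i -> x i = z i.

Let D d := C d `\` T d.
Let pos (B : set E) := forall d, exists z, B z /\ D d z.

Let D_anti c d : R c d -> D d `<=` D c.
Proof.
move=> Rcd z [Cz nTz]; split; first exact: C_anti Rcd _ Cz.
by move=> [b bc gz]; apply: nTz; exists b => //; exact: (below_subset RW Rcd).
Qed.

Let pos_sub A B : A `<=` B -> pos A -> pos B.
Proof. by move=> AB pA d; have [z [/AB]] := pA d; exists z. Qed.

Let pos_bigcup (A : nat -> set E) : pos (\bigcup_n A n) -> exists n, pos (A n).
Proof.
move=> pA; apply: contrapT => /forallNP nA.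
have /choice[u hu] : forall n, exists d, forall z, ~ (A n z /\ D d z).
  by move=> n; have /existsNP[d /forallNP] := nA n; exists d.
have [d hd] := seq_bounded RW u.
have [z [[n _ Az] Dz]] := pA d.
by apply: (hu n z); split=> //; exact: D_anti (below_le RW (hd n)) _ Dz.
Qed.

Let pos_diff A B : G A -> pos B -> pos (B `\` A).
Proof.
rewrite -G_range => -[b _ <-] pB d.
have [e he] := seq_bounded RW (fun n => if n is 0%N then b else d).
have [z [Bz Dz]] := pB e; exists z; split.
  by split=> // gz; apply: Dz.2; exists b => //; exact: (he 0%N).
exact: D_anti (below_le RW (he 1%N)) _ Dz.
Qed.

Let pos0 : ~ pos set0.
Proof.
have [w _] := omega1_neq0 RW.
by move=> /(_ w) [z []].
Qed.

Let E_compact := product_compact K_compact (W := W).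

(** A move of the first player: an enumerated cover of [X] by cylinders whose
    closures all miss some point [z] outside [X] at which [B] accumulates
    positively. *)
Let cover_move B : pos B -> exists e : nat -> W * nat,
  (forall x, X x -> exists i, cyl J (e i) x) /\
  forall k, pos (B `\` \bigcup_(i in `I_k.+1) cyl J (e i)).
Proof.
move=> pB.
have [z nXz hz] :=
  pos_escape E_compact G_alster pos0 pos_sub pos_bigcup pos_diff pB.
have [|x Xx|e [eP eX]] := @lindelof_subsequence E X (W * nat)
    (fun p => nbhs z (~` cyl J p)) (cyl J) X_lindelof X_neq0.
- exact: cyl_open J_open.
- have xz : x <> z by move=> xz; apply: nXz; rewrite -xz.
  by have [p] := cyl_separation K_hausdorff J_base xz; exists p.
exists e; split=> // k.
have : nbhs z (\bigcap_(i in `I_k.+1) ~` cyl J (e i)).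
  by apply: filter_bigcap_lt => i _; exact: eP.
by move=> /hz; apply: pos_sub => x [nx Bx]; split=> // -[i ik /(nx i ik)].
Qed.

(** Otherwise the first player could follow the strategy that keeps a positive
    closed set away from the answers, along an index closed under it. *)
Lemma absorbing_index : exists d, C d `<=` T d.
Proof.
apply: contrapT => /forallNP nCT.
have posT : pos setT.
  move=> d; have /existsNP[z /not_implyP[Cz nTz]] := nCT d.
  by exists z.
have [w _] := omega1_neq0 RW.
have /choice[e he] : forall B, exists e : nat -> W * nat, pos B ->
    (forall x, X x -> exists i, cyl J (e i) x) /\
    forall k, pos (B `\` \bigcup_(i in `I_k.+1) cyl J (e i)).
  move=> B; have [/cover_move[e]|nB] := pselect (pos B); first by exists e.
  by exists (fun=> (w, 0%N)).
have /choice[av hav] : forall Bb : set E * W, exists B',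
    closed Bb.1 -> pos Bb.1 ->
    [/\ closed B', pos B' & B' `<=` Bb.1 `\` g Bb.2].
  move=> [B b] /=; have [cB|nB] := pselect (closed B); last by exists B.
  have [pB|nB] := pselect (pos B); last by exists B.
  have Gb : G (g b) by rewrite -G_range; exists b.
  have [B' ?] := pos_diff_closed G_alster pos_sub pos_bigcup pos_diff Gb cB pB.
  by exists B'.
pose answer B k := B `\` \bigcup_(i in `I_k.+1) cyl J (e B i).
(* The position after a history, latest move first: an entry [(b, k)] means that
   the answer was the first [k.+1] cylinders, and that [g b] is avoided next. *)
pose st := fix st (h : seq (W * nat)) : set E :=
  if h is p :: h' then av (answer (st h') p.2, p.1) else setT.
have answer_pos B k : closed B -> pos B ->
    closed (answer B k) /\ pos (answer B k).
  move=> cB pB; split; last exact: (he B pB).2.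
  apply: closedI => //; apply: open_closedC; apply: bigcup_open => i _.
  exact: cyl_open J_open _.
have st_pos h : closed (st h) /\ pos (st h).
  elim: h => [|p h [cB pB]] /=; first by split=> //; exact: closedT.
  have [cA pA] := answer_pos _ p.2 cB pB.
  by have [] := hav (answer (st h) p.2, p.1) cA pA.
have st_step p h : st (p :: h) `<=` answer (st h) p.2 `\` g p.1.
  have [cB pB] := st_pos h; have [cA pA] := answer_pos _ p.2 cB pB.
  by have [] := hav (answer (st h) p.2, p.1) cA pA.
(* [d] bounds the coordinates used in all positions where only sets [g b] with
   [b] below [d] were avoided; in the play they are all avoided, one by one. *)
have /choice[u hu] : forall h, exists c, forall i, below R c (e (st h) i).1.
  by move=> h; exact: (seq_bounded RW).
have [d [wd hd]] := closing_off RW u w.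
have [|b bd] := countable_enum (countable_below RW d); first by exists w.
pose hist := fix hist (s : seq nat) : seq (W * nat) :=
  if s is k :: s' then (b (size s'), k) :: hist s' else [::].
have hist_below s p : p \in hist s -> below R d p.1.
  elim: s => //= k s IH; rewrite inE => /orP[/eqP ->|] //=.
  by rewrite -bd; exists (size s).
pose U s : set (set_type X) := if s is k :: s' then
    set_val @^-1` (\bigcup_(i in `I_k.+1) cyl J (e (st (hist s')) i))
  else set0.
have [|||f hf] := menger_game (U := U) _ _ _ X_menger.
- move=> k s.
  exists (\bigcup_(i in `I_k.+1) cyl J (e (st (hist s)) i)) => //.
  by apply: bigcup_open => i _; exact: cyl_open J_open _.
- move=> k m s km x [i ik ex]; exists i => //.
  by move: ik => /= ik; rewrite (leq_trans ik).
- move=> s x; have [i ei] := (he _ (st_pos (hist s)).2).1 _ (set_valP x).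
  by exists i; exists i => /=.
pose B n := st (hist (play f n)).
have B_step n : B n.+1 `<=` answer (B n) (f n) `\` g (b n).
  have sz : size (play f n) = n by elim: n => //= n ->.
  by move=> x /st_step /=; rewrite sz.
have B_anti m n : (m <= n)%N -> B n `<=` B m.
  elim: n => [|n IH]; first by rewrite leqn0 => /eqP ->.
  rewrite leq_eqVlt => /orP[/eqP -> //|]; rewrite ltnS => /IH h x.
  by move=> /B_step[[/h]].
(* Compactness: a point [z] of [C d] in all the positions of the play. *)
pose F : set_system E := [set S | exists n, C d `&` B n `<=` S].
have FF : ProperFilter F.
  apply: Build_ProperFilter_ex => [S [n hn]|].
    have [z [Bz [Cz _]]] := (st_pos (hist (play f n))).2 d.
    by exists z; apply: hn.
  split=> [|S1 S2 [n1 h1] [n2 h2]|S1 S2 S12 [n1 h1]].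
  - by exists 0%N.
  - exists (maxn n1 n2) => z [Cz Bz].
    split; [apply: h1 | apply: h2]; split=> //; apply: B_anti Bz.
      exact: leq_maxl.
    exact: leq_maxr.
  - by exists n1 => z /h1/S12.
have [z [_ zF]] := E_compact FF filterT.
have Bz n : B n z.
  apply: (st_pos (hist (play f n))).1 => V zV.
  have FB : F (B n) by exists n => x [].
  exact: zF _ _ FB zV.
have Cz : C d z.
  apply: (@C_closed d) => V zV.
  have FB : F (C d) by exists 0%N => x [].
  exact: zF _ _ FB zV.
have nTz : ~ T d z.
  move=> [c]; rewrite -bd => -[n _ <-] gz.
  by have [_] := B_step n z (Bz n.+1).
(* A point of [X] that agrees with [z] below [d] is in a cylinder over a
   coordinate below [d] that was removed from the positions. *)
have [x Xx xz] := C_sat Cz nTz.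
have [n [i ik ex]] := hf (exist _ x (mem_set Xx)).
have [[_ nz] _] := B_step n z (Bz n.+1).
apply: nz; exists i => //.
move: ex; rewrite /cyl /= -xz //.
have := hd (hist (play f n)) (@hist_below _).
by move=> /(below_subset RW); apply; exact: hu.
Qed.

End Absorption.

(** * A Lindelof space with a diagonal *)

Section MichaelSpace.
Variables (W : eqType) (R : rel W) (K : topologicalType) (J : nat -> set K).
Hypothesis RW : omega1 R.

Local Notation E := (prod_topology (fun _ : W => K)).

Definition supp_below (d : W) (s : seq (W * nat)) :=
  forall p, p \in s -> below R d p.1.

Variables (X : set E) (g : W -> set E) (a : W -> E).

Definition escaping (d : W) (z : E) : Prop :=
  ~ (\bigcup_(b in below R d) g b) z /\
  forall x, X x -> exists2 i, below R d i & x i <> z i.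

(** [Tail d z] stands for the restriction of [z] to the coordinates below [d];
    points with the same restriction have the same neighbourhoods. *)
Variant mpoint := Iso (b : W) | Tail (d : W) (z : E) of escaping d z.

(** Raising the level is allowed but not lowering it, so that the box still
    constrains only coordinates below the level: this makes these sets open. *)
Definition tail_nbhs (d : W) (s : seq (W * nat)) : set mpoint := [set y |
  match y with
  | Iso b => box J s (a b)
  | @Tail c z _ => R d c /\ box J s z
  end].

Definition mopen (V : set mpoint) :=
  forall d z (dz : escaping d z), V (Tail dz) ->
  exists s, [/\ supp_below d s, box J s z & tail_nbhs d s `<=` V].

Lemma supp_below_mono c d s : R c d -> supp_below c s -> supp_below d s.
Proof. by move=> Rcd sc p /sc; exact: (below_subset RW Rcd). Qed.

Lemma tail_nbhs_anti c d s : R c d -> tail_nbhs d s `<=` tail_nbhs c s.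
Proof. by move=> Rcd [b|e z ez] //= [/(omega1_trans RW Rcd)]. Qed.

Lemma mopenT : mopen setT.
Proof. by move=> d z dz _; exists [::]. Qed.

Lemma mopenI : setI_closed mopen.
Proof.
move=> A B oA oB d z dz [/oA[s [sd sz sA]] /oB[t [td tz tB]]].
exists (s ++ t); split=> [p|p|y hy].
- by rewrite mem_cat => /orP[/sd|/td].
- by rewrite mem_cat => /orP[/sz|/tz].
split; [apply: sA | apply: tB]; move: y hy => [b|c y cy] /=.
- by move=> h p ps; apply: h; rewrite mem_cat ps.
- by move=> [? h]; split=> // p ps; apply: h; rewrite mem_cat ps.
- by move=> h p ps; apply: h; rewrite mem_cat ps orbT.
- by move=> [? h]; split=> // p ps; apply: h; rewrite mem_cat ps orbT.
Qed.

Lemma mopen_bigcup (I : Type) (V : I -> set mpoint) :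
  (forall i, mopen (V i)) -> mopen (\bigcup_i V i).
Proof.
move=> oV d z dz [i _ /oV[s [sd sz sV]]]; exists s; split=> //.
by apply: (subset_trans sV); exact: bigcup_sup.
Qed.

HB.instance Definition _ := gen_eqMixin mpoint.
HB.instance Definition _ := gen_choiceMixin mpoint.
HB.instance Definition _ :=
  isOpenTopological.Build mpoint mopenT mopenI mopen_bigcup.

Definition michael_space : topologicalType := mpoint.

Lemma michael_openE (V : set michael_space) : open V = mopen V.
Proof. by []. Qed.

Lemma open_tail_nbhs d s :
  supp_below d s -> @open michael_space (tail_nbhs d s).
Proof.
rewrite michael_openE => sd c z cz [Rdc sz]; exists s; split=> //.
  exact: supp_below_mono sd.
exact: tail_nbhs_anti.
Qed.

Lemma open_Iso b : @open michael_space [set Iso b].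
Proof. by rewrite michael_openE => d z dz. Qed.

Section MichaelLindelof.
Hypothesis K_compact : compact [set: K].
Hypothesis K_hausdorff : hausdorff_space K.
Hypothesis J_open : forall n, open (J n).
Hypothesis J_base : forall (U : set K) x, open U -> U x ->
  exists2 n, J n x & J n `<=` U.
Variable G : set (set E).
Hypothesis X_neq0 : X !=set0.
Hypothesis X_lindelof : lindelof (set_type X).
Hypothesis X_menger : menger (set_type X).
Hypothesis G_alster : alster_covering X G.
Hypothesis G_range : range g = G.
Hypothesis a_notin : forall d b, below R d b -> ~ g b (a d).

(** From an index [d] with [C d `<=` T d] on, everything is covered by the
    countably many members chosen for the boxes below [d]; each of the countably
    many levels up to [d] is second countable. *)
Lemma michael_lindelof : lindelof michael_space.
Proof.
move=> UU [oU covU].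
pose P s d := supp_below d s /\ exists2 A, UU A & tail_nbhs d s `<=` A.
pose C d := ~` \bigcup_(s in [set s | P s d]) box J s.
have P_mono s c d : R c d -> P s c -> P s d.
  move=> Rcd [sc [A UA sA]]; split; first exact: supp_below_mono sc.
  by exists A => //; apply: subset_trans sA; exact: tail_nbhs_anti.
have P_tail d z (dz : escaping d z) : exists2 s, P s d & box J s z.
  have : [set: michael_space] (Tail dz) by [].
  rewrite -covU => -[A UA /=]; have := oU A UA; rewrite michael_openE => oA.
  by move=> /oA[s [sd sz sA]]; exists s => //; split=> //; exists A.
have [||d|d Cd] := absorbing_index (C := C) RW K_compact K_hausdorff J_open
    J_base X_neq0 X_lindelof X_menger G_alster G_range.
- move=> d; apply: open_closedC; apply: bigcup_open => s _.
  exact: open_box.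
- by move=> c d Rcd z Cz [s Ps sz]; apply: Cz; exists s => //; exact: P_mono Ps.
- move=> z Cz nTz; apply: contrapT => nx; apply: Cz.
  have [|s Ps sz] := P_tail d z; last by exists s.
  split=> // x Xx; apply: contrapT => ni; apply: nx; exists x => // i id.
  by apply: contrapT => xz; apply: ni; exists i.
have /choice[tl htl] : forall sc : seq (W * nat) * W, exists A, P sc.1 sc.2 ->
    UU A /\ tail_nbhs sc.2 sc.1 `<=` A.
  move=> [s c] /=; have [[sc [A UA sA]]|nP] := pselect (P s c).
    by exists A.
  by exists setT.
have /choice[iso hiso] : forall b, exists A, UU A /\ A (Iso b).
  move=> b; have : [set: michael_space] (Iso b) by [].
  by rewrite -covU => -[A UA Ab]; exists A.
pose V1 := \bigcup_(c in [set c | R c d])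
  ((fun s => tl (s, c)) @` [set s | P s c]).
pose V2 := iso @` [set b | R b d].
have segd : countable [set b | R b d] by case: RW => _ _; apply.
exists (V1 `|` V2); split.
- move=> A [[c _ [s Ps <-]]|[b _ <-]]; last exact: (hiso b).1.
  exact: (htl (s, c) Ps).1.
- apply: countable_setU.
    apply: bigcup_countable => // c _.
    apply: sub_countable (card_image_le _ _) _.
    apply: sub_countable (countable_lists RW nat c); apply: subset_card_le => s.
    by case.
  exact: sub_countable (card_image_le _ _) segd.
have late s : P s d -> (V1 `|` V2) (tl (s, d)).
  by move=> Ps; left; exists d; [exact: omega1_refl | exists s].
have outside z : ~ (\bigcup_(b in below R d) g b) z ->
    exists2 s, P s d & box J s z.
  move=> nTz; apply: contrapT => ns; apply: nTz; apply: Cd => -[s Ps sz].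
  by apply: ns; exists s.
apply/seteqP; split=> // -[b|c z cz] _.
- have [Rbd|nbd] := boolP (R b d).
    by exists (iso b); [right; exists b | exact: (hiso b).2].
  have [|s Ps sb] := outside (a b).
    move=> [i id]; apply: a_notin; apply: (below_subset RW) id.
    by apply: (below_le RW).
  by exists (tl (s, d)); [exact: late | apply: (htl (s, d) Ps).2].
- have [Rcd|ncd] := boolP (R c d).
    have [s Ps sz] := P_tail c z cz; exists (tl (s, c)).
      by left; exists c => //; exists s.
    by apply: (htl (s, c) Ps).2; split=> //; exact: omega1_refl.
  have Rdc : R d c by apply: (below_le RW).
  have [|s Ps sz] := outside z.
    move=> [i id gz]; apply: cz.1; exists i => //.
    exact: (below_subset RW Rdc).
  by exists (tl (s, d)); [exact: late | apply: (htl (s, d) Ps).2; split].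
Qed.

End MichaelLindelof.

(** The open sets that contain [(a b, Iso b)] for only countably many [b] cover
    the product: disjoint boxes at a coordinate where a point of [X] differs
    from a tail give an open set that contains none of these points. *)
Lemma michael_product : hausdorff_space K ->
  (forall (U : set K) x, open U -> U x -> exists2 n, J n x & J n `<=` U) ->
  (forall b, X (a b)) -> ~ lindelof (set_type X * michael_space)%type.
Proof.
move=> K_hausdorff J_base Xa lXY.
pose diag (V : set (set_type X * michael_space)) : set W :=
  [set b | V (exist _ (a b) (mem_set (Xa b)), Iso b)].
have snd_open (V : set michael_space) : open V ->
    open (snd @^-1` V : set (set_type X * michael_space)).
  by move=> oV; apply: open_comp oV => p _; exact: cvg_snd.
have fst_open (V : set (set_type X)) : open V ->
    open (fst @^-1` V : set (set_type X * michael_space)).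
  by move=> oV; apply: open_comp oV => p _; exact: cvg_fst.
have [|V [VU cV covV]] := lXY [set V | open V /\ countable (diag V)].
  split=> [V []//|]; apply/seteqP; split=> // -[x [b|d z dz]] _.
    exists (snd @^-1` [set Iso b]) => //; split; first exact/snd_open/open_Iso.
    apply: (@sub_countable _ _ _ [set b]); last exact: countable1.
    by apply: subset_card_le => c [].
  have [i id xz] := dz.2 _ (set_valP x).
  have [n [Jz [U oU [Ux JU]]]] :=
    coord_separation K_hausdorff J_base (fun h => xz (esym h)).
  exists (fst @^-1` (set_val @^-1` [set y : E | U (y i)])
          `&` snd @^-1` tail_nbhs d [:: (i, n)]).
    split.
      apply: openI.
        apply: fst_open; exists [set y : E | U (y i)] => //; exact: coord_open.
      by apply/snd_open/open_tail_nbhs => p; rewrite inE => /eqP ->.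
    apply: (@sub_countable _ _ _ set0); last exact: countable0.
    apply: subset_card_le => b [/= Ub /(_ (i, n) (mem_head _ _)) Jb].
    have : (J n `&` U) (a b i) by split; [exact: Jb | exact: Ub].
    by rewrite JU.
  split=> //=; split; first exact: omega1_refl.
  by move=> p; rewrite inE => /eqP ->.
case: RW => _ + _; apply.
apply: (@sub_countable _ _ _ (\bigcup_(A in V) diag A)); last first.
  by apply: bigcup_countable => // A /VU[].
apply: subset_card_le => b _.
have : [set: (set_type X * michael_space)%type]
  (exist _ (a b) (mem_set (Xa b)), Iso b) by [].
by rewrite -covV => -[A VA Ab]; exists A.
Qed.

End MichaelSpace.

(** * The unit interval *)

Lemma compact_set_type (T : topologicalType) (A : set T) :
  compact A -> compact [set: set_type A].
Proof.
move=> cA F FF _.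
have FA : (@set_val _ A @ F) A.
  by apply: (@filterS _ F _ setT _ _ filterT) => x _; exact: set_valP.
have [x [Ax xF]] := cA _ (fmap_proper_filter _ FF) FA.
exists (exist _ x (mem_set Ax)); split=> // S N FS [_ [[V oV <-] Vx VN]].
have FS' : (@set_val _ A @ F) (set_val @` S).
  by apply: (@filterS _ F _ S _ _ FS) => z Sz; exists z.
have [y [[z Sz zy] Vy]] := xF _ V FS' (open_nbhs_nbhs (conj oV Vx)).
by exists z; split=> //; apply: VN; rewrite /= zy.
Qed.

Lemma hausdorff_set_type (T : topologicalType) (A : set T) :
  hausdorff_space T -> hausdorff_space (set_type A).
Proof.
rewrite !open_hausdorff => hT x y xy.
have [|[U V] /= [xU yV] [oU oV /eqP UV]] := hT (set_val x) (set_val y).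
  by apply: contra xy => /eqP/val_inj ->.
exists (set_val @^-1` U, set_val @^-1` V) => /=.
  by split; rewrite inE; move: xU yV; rewrite !inE.
split; [by exists U | by exists V |].
by apply/eqP; rewrite -preimage_setI UV preimage_set0.
Qed.

Lemma real_base (R : realType) : exists J : nat -> set R,
  (forall n, open (J n)) /\
  forall (U : set R) x, open U -> U x -> exists2 n, J n x & J n `<=` U.
Proof.
exists (fun n => if unpickle n is Some (p, q)
  then [set` `]ratr p, ratr q[%R] else setT).
split=> [n|U x oU Ux].
  by case: unpickle => [[p q]|]; [exact: interval_open | exact: openT].
have : nbhs x U by exact: open_nbhs_nbhs.
rewrite -nbhs_ballE => -[e /= e0 eU].
have [p pin] : exists q : rat, ratr q \in `]x - e, x[%R.
  have [|q] := @rat_in_itvoo R (x - e)%R x; last by exists q.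
  by rewrite ltrBlDr ltrDl.
have [q qin] : exists q : rat, ratr q \in `]x, x + e[%R.
  by have [|q] := @rat_in_itvoo R x (x + e)%R; [rewrite ltrDl | exists q].
move: pin qin; rewrite !in_itv /= => /andP[p1 p2] /andP[q1 q2].
exists (pickle (p, q)); rewrite pickleK /=; first by rewrite in_itv /= p2 q1.
move=> y; rewrite /= in_itv /= => /andP[py yq]; apply: eU.
rewrite /ball /= ltr_distlC; apply/andP; split; first exact: lt_trans py.
exact: lt_trans yq q2.
Qed.

(** * The theorem *)

Theorem theorem3p3 (R : realType) (W : eqType) (leW : rel W)
    (W_omega1 : omega1 leW)
    (X : set (cube R W))
    (X_prod_lindelof : productively_lindelof (set_type X))
    (X_menger : menger (set_type X))
    (G : set (set (cube R W)))
    (G_alster : alster_covering X G)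
    (G_card : (G #= [set: W])%card)
    (G_lindelof : forall A, G A -> lindelof (set_type A)) :
  exists G' : set (set (cube R W)),
    [/\ G' `<=` G, (G' #= [set: nat])%card & X `<=` \bigcup_(A in G') A].
Proof.
have K_compact : compact [set: unit_interval R].
  by apply: compact_set_type; exact: segment_compact.
have K_hausdorff : hausdorff_space (unit_interval R).
  by apply: hausdorff_set_type; exact: Rhausdorff.
have [J0 [J0_open J0_base]] := real_base R.
pose J n : set (unit_interval R) := set_val @^-1` J0 n.
have J_open n : open (J n) by exists (J0 n).
have J_base (U : set (unit_interval R)) x : open U -> U x ->
    exists2 n, J n x & J n `<=` U.
  move=> [V oV <-] Vx; have [n Jx JV] := J0_base V (set_val x) oV Vx.
  by exists n => // y /JV.
have G_inf : infinite_set G.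
  move=> /finite_set_countable cG; case: W_omega1 => _ + _; apply.
  by rewrite -(eq_countable G_card).
(* Added to a countable subfamily, [N] makes it countably infinite. *)
have [N NG Ncard] : exists2 N, N `<=` G & (N #= [set: nat])%card.
  have /infiniteP/pcard_leP[f] := G_inf; exists (range f).
    by move=> _ [n _ <-]; exact: funS.
  by apply: inj_card_eq; exact: inj.
have [g g_range] : exists g : W -> set (cube R W), range g = G.
  have /card_set_bijP[g [gG _ Gg]] := card_esym G_card; exists g.
  by apply/seteqP; split=> // _ [b _ <-]; exact: gG.
apply: contrapT => nG'.
have /choice[a ha] : forall d, exists x,
    X x /\ forall b, below leW d b -> ~ g b x.
  move=> d; apply: contrapT => /forallNP na; apply: nG'.
  exists (N `|` g @` below leW d); split.
  - by move=> A [/NG //|[b _ <-]]; rewrite -g_range; exists b.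
  - rewrite card_eq_le; apply/andP; split.
      apply: countable_setU.
        by move: Ncard; rewrite /countable card_eq_le => /andP[].
      exact: sub_countable (card_image_le _ _) (countable_below W_omega1 d).
    move: Ncard; rewrite card_eq_le => /andP[_ /card_le_trans]; apply.
    exact: subset_card_le.
  - move=> x Xx.
    have /not_andP[//|/existsNP[b /not_implyP[bd /contrapT gx]]] := na x.
    by exists (g b) => //; right; exists b.
have [w _] := omega1_neq0 W_omega1.
have X_neq0 : X !=set0 by exists (a w); exact: (ha w).1.
apply: (@michael_product W leW _ J W_omega1 X g a K_hausdorff J_base).
  by move=> b; exact: (ha b).1.
apply: X_prod_lindelof.2.
apply: (michael_lindelof W_omega1 K_compact K_hausdorff J_open J_base X_neq0
  X_prod_lindelof.1 X_menger G_alster g_range).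
by move=> d b; exact: (ha d).2.
Qed.
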